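(* Let $m\ge n$ be positive integers, and let $G$ be a $(1,2)$-step competition graph of an orientation of $K_{m,n}$ having the minimum possible number of edges among all orientations of $K_{m,n}$. Then $|E(G)|=0$ if $m=n=2$, and $|E(G)|=\binom{n}{2}$ otherwise.
   Context: For vertices $x,y$ of a digraph $H$, $d_H(x,y)$ is the length of a shortest directed $(x,y)$-path. The $(1,2)$-step competition graph $C_{1,2}(D)$ of a digraph $D$ is the simple graph on $V(D)$ in which distinct $u,v$ are adjacent iff there is $w\neq u,v$ with either $d_{D-v}(u,w)\le 1$ and $d_{D-u}(v,w)\le 2$, or $d_{D-u}(v,w)\le 1$ and $d_{D-v}(u,w)\le 2$. *)

(* Defs.v *)
From mathcomp Require Import all_boot.

Set Implicit Arguments.
Unset Strict Implicit.
Unset Printing Implicit Defensive.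

Record sgraph (T : finType) := SGraph {
  adj :> rel T;
  adj_sym : symmetric adj;
  adj_irr : irreflexive adj }.

Definition edges (T : finType) (G : sgraph T) : {set {set T}} :=
  [set [set p.1; p.2] | p : T * T & G p.1 p.2].

(* A digraph on the vertex set T is given by its arc relation D : rel T.
   For D - v the type of vertices is kept and v is made isolated; this does not
   affect the distance between two vertices different from v. *)
Definition del_vertex (T : finType) (D : rel T) (v : T) : rel T :=
  [rel x y | [&& x != v, y != v & D x y]].

(* The vertices of the path are x :: p, so its length is size p. *)
Definition dipath (T : finType) (D : rel T) (x y : T) (p : seq T) : bool :=
  [&& path D x p, last x p == y & uniq (x :: p)].

(* None stands for an infinite distance. A path has no repeated vertex, hence
   length less than #|T|, so the range below covers all possible lengths. *)
Definition dist (T : finType) (D : rel T) (x y : T) : option nat :=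
  ohead [seq k <- iota 0 #|T| | [exists p : k.-tuple T, dipath D x y p]].

Definition dist_le (T : finType) (D : rel T) (x y : T) (k : nat) : bool :=
  if dist D x y is Some d then d <= k else false.

Definition comp12_adj (T : finType) (D : rel T) : rel T :=
  [rel u v | (u != v) &&
     [exists w, [&& w != u, w != v &
        (dist_le (del_vertex D v) u w 1 && dist_le (del_vertex D u) v w 2)
     || (dist_le (del_vertex D u) v w 1 && dist_le (del_vertex D v) u w 2)]]].

Lemma comp12_sym (T : finType) (D : rel T) : symmetric (comp12_adj D).
Proof.
move=> u v; rewrite /comp12_adj /= eq_sym; congr (_ && _).
by apply: eq_existsb => w; rewrite andbCA orbC.
Qed.

Lemma comp12_irr (T : finType) (D : rel T) : irreflexive (comp12_adj D).
Proof. by move=> u; rewrite /comp12_adj /= eqxx. Qed.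

Definition comp12 (T : finType) (D : rel T) : sgraph T :=
  SGraph (comp12_sym D) (comp12_irr D).

Definition Kmn_adj (m n : nat) : rel ('I_m + 'I_n) := fun x y =>
  match x, y with
  | inl _, inr _ | inr _, inl _ => true
  | _, _ => false
  end.

Lemma Kmn_sym (m n : nat) : symmetric (@Kmn_adj m n).
Proof. by case=> ? []. Qed.

Lemma Kmn_irr (m n : nat) : irreflexive (@Kmn_adj m n).
Proof. by case. Qed.

Definition Kmn (m n : nat) : sgraph ('I_m + 'I_n)%type :=
  SGraph (@Kmn_sym m n) (@Kmn_irr m n).

Definition orientation (T : finType) (G : sgraph T) (D : rel T) : Prop :=
  forall x y : T, (G x y = (D x y || D y x)) /\ ~~ (D x y && D y x).

(* Main.v *)
Require Import Defs.
From mathcomp Require Import all_boot zify.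
Set Implicit Arguments.
Unset Strict Implicit.
Unset Printing Implicit Defensive.

(* Orienting all arcs from the side of size n to the other side leaves only the
   C(n, 2) edges inside the smaller side, and a directed 4-cycle has no edge.
   For the lower bound, every balanced sub-bipartite-tournament with sides of
   size n >= 3 has a vertex with at least n - 1 neighbours; deleting it and
   inducting gives n(n - 1)/2 edges. Sides of sizes at least 2, not both equal
   to 2, contain a vertex of indegree at least 2, hence an edge: this is the base.

   The vertex of large degree is found in N, the in-neighbourhood of a vertex w
   of maximum indegree d >= n/2. Let A u be the set of common out-neighbours of
   N minus u. By u -> w <- x <- v, every u in N is adjacent to the rest of N and
   to all vertices v of the side of w outside A u, so its degree is at least
   d - 1 + n - |A u|. If all degrees are below n - 1, then |A u| > d for all u;
   the set C of common out-neighbours of N has size at most d, as it lies in the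
   in-neighbourhood of any vertex on the side of N outside N. Counting the A u
   then forces n = 2d and |C| = d, and so a vertex v of A u outside C loses to
   N minus u and to the whole complement of N, 2d - 1 > d vertices in all. *)

(** * Bounded distance as existence of a short path *)

Lemma ohead_filter_iota (a : pred nat) m n j :
  j \in iota m n -> a j ->
  exists2 d, ohead [seq k <- iota m n | a k] = Some d & d <= j.
Proof.
elim: n m => [|n IHn] m //=; rewrite inE => /orP[/eqP-> -> | jmn aj].
  by exists m.
case: ifP => _ /=; last exact: IHn.
by exists m => //; move: jmn; rewrite mem_iota => /andP[/ltnW].
Qed.

Lemma dist_leP (T : finType) (D : rel T) x y k :
  reflect (exists2 p, dipath D x y p & size p <= k) (dist_le D x y k).
Proof.
rewrite /dist_le /dist; apply: (iffP idP) => [|[p Dp pk]].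
  set s := filter _ _ => sk.
  have: all (fun d => [exists p : d.-tuple T, dipath D x y p]) s.
    exact: filter_all.
  case: s sk => //= d s dk /andP[/existsP[p Dp] _].
  by exists p; rewrite ?size_tuple.
set a := fun d => _.
have ap : a (size p) by apply/existsP; exists (in_tuple p).
have ltpT : size p \in iota 0 #|T|.
  rewrite mem_iota /= add0n; case/and3P: Dp => _ _ /card_uniqP /= <-.
  exact: max_card.
have [d -> dp] := ohead_filter_iota ltpT ap.
exact: leq_trans pk.
Qed.

Lemma card_subset_exists (T : finType) (B : {set T}) k : k <= #|B| ->
  exists2 B' : {set T}, B' \subset B & #|B'| = k.
Proof.
move=> kB; have : 0 < #|[set B' : {set T} | (B' \subset B) && (#|B'| == k)]|.
  by rewrite cards_draws bin_gt0.
by case/card_gt0P => B'; rewrite inE => /andP[sub /eqP]; exists B'.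
Qed.

(** * Sufficient conditions for adjacency *)

Section Antisymmetric.

Variables (T : finType) (D : rel T).
Hypothesis D_asym : forall x y, ~~ (D x y && D y x).

Lemma asym_neq x y : D x y -> x != y.
Proof. by apply: contraTneq => <-; move: (D_asym x x); rewrite andbb. Qed.

Lemma dist_le_arc u x y k :
  0 < k -> x != u -> y != u -> D x y -> dist_le (del_vertex D u) x y k.
Proof.
move=> k0 xu yu Dxy; apply/dist_leP; exists [:: y] => //.
by rewrite /dipath /del_vertex /= xu yu Dxy eqxx inE asym_neq.
Qed.

Lemma comp12_common u v w : u != v -> D u w -> D v w -> comp12_adj D u v.
Proof.
move=> uv Duw Dvw.
have vu : v != u by rewrite eq_sym.
have wu : w != u by rewrite eq_sym asym_neq.
have wv : w != v by rewrite eq_sym asym_neq.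
rewrite /comp12_adj /= uv; apply/existsP; exists w.
by rewrite wu wv !dist_le_arc.
Qed.

(** The arc [u -> w] survives the deletion of [v], and the path [v -> x -> w] survives that of
    [u]. *)
Lemma comp12_two_step u v w x :
  u != v -> u != x -> v != w -> D u w -> D v x -> D x w -> comp12_adj D u v.
Proof.
move=> uv ux vw Duw Dvx Dxw.
have vu : v != u by rewrite eq_sym.
have wu : w != u by rewrite eq_sym asym_neq.
have wv : w != v by rewrite eq_sym.
rewrite /comp12_adj /= uv; apply/existsP; exists w.
rewrite wu wv dist_le_arc //=; apply/orP; left.
apply/dist_leP; exists [:: x; w] => //.
rewrite /dipath /del_vertex /= !inE Dvx Dxw eqxx vu wu [x == u]eq_sym ux.
by rewrite !negb_or vw !asym_neq.
Qed.

End Antisymmetric.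

(** * Necessary conditions for adjacency *)

Lemma dist_le_last_arc (T : finType) (D : rel T) u v w k :
  v != w -> dist_le (del_vertex D u) v w k ->
  exists2 x, D x w & x != u.
Proof.
move=> vw /dist_leP[p /and3P[]]; case/lastP: p => [|p y].
  by move=> _ /=; rewrite (negbTE vw).
rewrite rcons_path last_rcons => /andP[_ /and3P[xu _ Dxy]] /eqP yw _ _.
by exists (last v p); rewrite -?yw.
Qed.

Lemma dist_le_first_arc (T : finType) (D : rel T) u v w k :
  v != w -> dist_le (del_vertex D u) v w k -> exists x, D v x.
Proof.
move=> vw /dist_leP[[|x p] /and3P[]] /=.
  by rewrite (negbTE vw).
by case/andP => /and3P[_ _ Dvx]; exists x.
Qed.

Lemma dist_le1 (T : finType) (D : rel T) u v w :
  v != w -> dist_le (del_vertex D u) v w 1 -> D v w && (v != u).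
Proof.
move=> vw /dist_leP[[|x [|y p]] /and3P[]] //=.
  by rewrite (negbTE vw).
by rewrite andbT => /and3P[-> _ Dvx] /eqP <-; rewrite Dvx.
Qed.

Lemma comp12_out (T : finType) (D : rel T) u v :
  comp12_adj D u v -> (exists x, D u x) /\ (exists x, D v x).
Proof.
case/andP=> _ /existsP[w /and3P[wu wv]].
rewrite eq_sym in wu; rewrite eq_sym in wv.
by case/orP=> /andP[/dist_le_first_arc-/(_ _)H /dist_le_first_arc-/(_ _)H'];
  split; auto.
Qed.

(** One end of the edge has an arc to [w]; the path from the other end avoids it, so its last arc
    enters [w] from a different vertex. *)
Lemma comp12_in (T : finType) (D : rel T) u v :
  comp12_adj D u v -> exists x y w, [/\ x != y, D x w & D y w].
Proof.
case/andP=> _ /existsP[w /and3P[wu wv]].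
rewrite eq_sym in wu; rewrite eq_sym in wv.
case/orP=> /andP[] /dist_le1-/(_ _)/andP[] // Dw _.
  by case/dist_le_last_arc=> // x Dx xu; exists x, u, w.
by case/dist_le_last_arc=> // x Dx xu; exists x, v, w.
Qed.

(** * Arc counting in bipartite tournaments *)

Section Degrees.

Variables (T : finType) (D : rel T) (c : T -> bool).
Hypothesis D_asym : forall x y, ~~ (D x y && D y x).
Hypothesis D_bip : forall x y, D x y || D y x = (c x != c y).

Implicit Types (S : {set T}) (u v w x y : T).

Definition side S b := [set x in S | c x == b].
Definition inN S y := [set x in S | D x y].
(** Adjacency stays that of the whole [D], and [S] only restricts the vertices counted; so removing
    a vertex from [S] loses only the edges at that vertex. *)
Definition nb S u := [set x in S | comp12_adj D u x].

Lemma arc_color x y : D x y -> c x != c y.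
Proof. by rewrite -D_bip => ->. Qed.

Lemma arcN x y : c x != c y -> ~~ D x y -> D y x.
Proof. by rewrite -D_bip => /orP[->|]. Qed.

Lemma arc_asym x y : D x y -> ~~ D y x.
Proof. by move=> Dxy; have := D_asym x y; rewrite Dxy. Qed.

(** Each pair across the two sides carries exactly one arc, counted at its head. *)
Lemma card_arcs S :
  \sum_(y in S) #|inN S y| = #|side S true| * #|side S false|.
Proof.
have inE' y : #|inN S y| = \sum_(x in S) D x y.
  rewrite -sum1_card big_mkcond [RHS]big_mkcond; apply: eq_bigr => x _.
  by rewrite inE; case: (x \in S); case: (D x y).
rewrite (bigID c) /=.
have E1 : \sum_(y in S | c y) #|inN S y| =
    \sum_(y in side S true) \sum_(x in side S false) D x y.
  apply: eq_big => [y|y /andP[yS cy]]; first by rewrite inE eqb_id.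
  rewrite inE' (bigID c) /= big1 ?add0n => [|x /andP[_ cx]].
    by apply: eq_bigl => x; rewrite inE eqbF_neg.
  by case Dxy: (D x y) => //; move: (arc_color Dxy); rewrite cx cy.
(* The sums are exchanged so that arcs in both directions are indexed by the same pairs and can be
   added termwise. *)
have E2 : \sum_(y in S | ~~ c y) #|inN S y| =
    \sum_(y in side S true) \sum_(x in side S false) D y x.
  rewrite exchange_big /=.
  apply: eq_big => [y|y /andP[yS cy]]; first by rewrite inE eqbF_neg.
  rewrite inE' (bigID c) /= addnC big1 ?add0n => [|x /andP[_ cx]].
    by apply: eq_bigl => x; rewrite inE eqb_id.
  case Dxy: (D x y) => //; move: (arc_color Dxy).
  by rewrite (negbTE cx) (negbTE cy).
rewrite E1 E2 -big_split /= -sum_nat_const; apply: eq_bigr => y.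
rewrite inE => /andP[_ /eqP cy]; rewrite -big_split /= -sum1_card.
apply: eq_bigr => x; rewrite inE => /andP[_ /eqP cx].
move: (D_asym x y) (D_bip x y); rewrite cx cy.
by case: (D x y); case: (D y x).
Qed.

Lemma card_side_le S d :
  (forall y, y \in S -> #|inN S y| <= d) ->
  #|side S true| * #|side S false| <= d * (#|side S true| + #|side S false|).
Proof.
move=> le_d; rewrite -card_arcs.
have -> : #|side S true| + #|side S false| = #|S|.
  rewrite -[RHS](cardsID [set x | c x]); congr (_ + _); apply: eq_card => x.
    by rewrite !inE eqb_id.
  by rewrite !inE eqbF_neg andbC.
by rewrite mulnC -sum_nat_const; apply: leq_sum.
Qed.

(** * A vertex of degree at least [n - 1] *)

Section LargeDegree.

Variables (S : {set T}) (n d : nat) (w : T).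
Hypotheses (card_side : forall b, #|side S b| = n) (wS : w \in S).
Hypotheses (d_w : #|inN S w| = d) (d_max : forall y, y \in S -> #|inN S y| <= d).
Hypotheses (d_gt1 : 1 < d) (n_le : n <= d.*2).

Let N := inN S w.
Let own := side S (c w).
Let opp := side S (~~ c w).
(* Common out-neighbours of [N] without [u]. *)
Let A u := [set v in own | [forall x in N :\ u, D x v]].
Let C := [set v in own | [forall x in N, D x v]].

Lemma N_sub_opp : N \subset opp.
Proof.
apply/subsetP => x; rewrite !inE => /andP[-> /arc_color].
by case: (c x); case: (c w).
Qed.

Lemma inN_own_sub v : v \in own -> inN S v \subset opp.
Proof.
rewrite inE => /andP[_ /eqP cv].
apply/subsetP => x; rewrite !inE => /andP[-> /arc_color].
by rewrite cv; case: (c x); case: (c w).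
Qed.

Lemma own_opp v x : v \in own -> x \in opp -> c v != c x.
Proof.
by rewrite !inE => /andP[_ /eqP->] /andP[_ /eqP->]; case: (c w).
Qed.

(** A subtraction-free form of [(d - 1) + (n - #|A u|) <= #|nb S u|]. The two terms count neighbours
    on opposite sides, hence disjoint sets. *)
Lemma degree_lower u : u \in N -> d + n <= #|nb S u| + #|A u|.+1.
Proof.
move=> uN; have uw : D u w by move: uN; rewrite inE => /andP[].
have uO : u \in opp by apply: (subsetP N_sub_opp).
have sub : (N :\ u) :|: (own :\: A u) \subset nb S u.
  apply/subsetP => v; rewrite in_setU => /orP[].
    rewrite !inE => /and3P[vu -> Dvw] /=.
    by apply: (comp12_common D_asym) Dvw => //; rewrite eq_sym.
  rewrite in_setD => /andP[vA vo].
  have vS : v \in S by move: vo; rewrite inE => /andP[].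
  move: vA; rewrite inE vo /= => /forall_inPn[x].
  rewrite 2!inE => /andP[xu xN] Dxv.
  have xO := subsetP N_sub_opp x xN.
  have Dvx : D v x.
    by apply: arcN Dxv; rewrite eq_sym own_opp.
  have Dxw : D x w by move: xN; rewrite inE => /andP[].
  rewrite inE vS; apply: (comp12_two_step D_asym _ _ _ uw Dvx Dxw).
  - by apply: contraNneq (own_opp vo uO) => ->.
  - by rewrite eq_sym.
  - by apply: contraTneq Dvx => ->; apply: arc_asym.
have := subset_leq_card sub; rewrite cardsU.
have -> : (N :\ u) :&: (own :\: A u) = set0.
  apply/setP => v; rewrite !inE; apply/negP.
  case/andP=> /and3P[_ _ /arc_color cv] /andP[_ /andP[_ /eqP cvw]].
  by rewrite cvw eqxx in cv.
have := cardsD1 u N; rewrite uN /N d_w cards0.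
have := cardsD own (A u).
have -> : own :&: A u = A u by apply/setIidPr/subsetP=> v; rewrite inE => /andP[].
have : #|A u| <= #|own|.
  by apply: subset_leq_card; apply/subsetP=> v; rewrite inE => /andP[].
by rewrite card_side; lia.
Qed.

Lemma large_degree : exists2 u, u \in S & n <= #|nb S u|.+1.
Proof.
have NS u : u \in N -> u \in S by rewrite inE => /andP[].
apply/exists_inP; apply: contraT; rewrite negb_exists_in => /forall_inP small.
have A_large u : u \in N -> d < #|A u|.
  by move=> uN; move: (degree_lower uN) (small u (NS u uN)); lia.
have [u0 u0N] : exists u, u \in N by apply/card_gt0P; rewrite d_w; lia.
have dn : d < n.
  have := A_large _ u0N; suff: #|A u0| <= n by lia.
  rewrite -(card_side (c w)); apply: subset_leq_card.
  by apply/subsetP=> v; rewrite inE => /andP[].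
have card_oppN : #|opp :\: N| = n - d.
  rewrite cardsD card_side (_ : opp :&: N = N) ?d_w //.
  exact/setIidPr/N_sub_opp.
have [z zON] : exists z, z \in opp :\: N.
  by apply/card_gt0P; rewrite card_oppN subn_gt0.
(* If [y] beat a vertex [v] of [C], then [v] would have [y] besides all of [N] as in-neighbours,
   exceeding the maximum [d]. *)
have C_sub y : y \in opp :\: N -> C \subset inN S y.
  rewrite in_setD => /andP[yN yO]; apply/subsetP => v.
  rewrite inE => /andP[vo /forall_inP vN].
  have vS : v \in S by move: vo; rewrite inE => /andP[].
  rewrite inE vS /=; apply: arcN; first by rewrite eq_sym own_opp.
  apply: contra yN => Dyv.
  have /eqP -> : N == inN S v.
    rewrite eqEcard d_w d_max // andbT; apply/subsetP => x xN.
    by rewrite inE vN // NS.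
  by rewrite inE Dyv andbT; move: yO; rewrite inE => /andP[].
have oppS y : y \in opp :\: N -> y \in S.
  by rewrite !inE => /andP[_ /andP[]].
have C_le : #|C| <= d.
  exact: leq_trans (subset_leq_card (C_sub z zON)) (d_max (oppS z zON)).
(* A vertex outside [C] misses some [x] in [N], so it lies in [A u] only if
   [u = x]; a vertex of [C] lies in all [d] sets [A u]. *)
have sumA : \sum_(u in N) #|A u| <= n + d.-1 * #|C|.
  have -> : \sum_(u in N) #|A u| = \sum_(v in own) \sum_(u in N) (v \in A u).
    rewrite exchange_big /=; apply: eq_bigr => u _.
    rewrite -sum1_card big_mkcond [RHS]big_mkcond; apply: eq_bigr => v _.
    by rewrite inE; case: (v \in own) => //=; case: ifP.
  have -> : n + d.-1 * #|C| = \sum_(v in own) (1 + d.-1 * (v \in C)).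
    rewrite big_split /= sum1_card card_side -big_distrr /=; congr (_ + _ * _).
    rewrite -sum1_card big_mkcond [RHS]big_mkcond; apply: eq_bigr => v _.
    by rewrite inE; case: (v \in own) => //=; case: ifP.
  apply: leq_sum => v vo; case: (boolP (v \in C)) => [_|].
    rewrite muln1 add1n prednK; last exact: ltnW.
    have -> : d = \sum_(u in N) 1 by rewrite sum1_card.
    by apply: leq_sum => u _; case: (_ \in _).
  rewrite inE vo /= => /forall_inPn[x xN Dxv].
  rewrite muln0 addn0 (bigD1 x) //= big1 ?addn0; first by case: (_ \in _).
  move=> u /andP[uN ux]; rewrite inE vo /=.
  apply/eqP; rewrite eqb0; apply/forall_inPn.
  by exists x; rewrite // in_setD1 eq_sym ux.
have sumA' : d * d.+1 <= \sum_(u in N) #|A u|.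
  by rewrite -{1}d_w -sum_nat_const; apply: leq_sum => u; apply: A_large.
(* With [n <= 2 * d] and [#|C| <= d], [d * d.+1 <= n + d.-1 * #|C|] is tight. *)
have [n_eq C_eq] : n = d.*2 /\ #|C| = d.
  by move: (leq_trans sumA' sumA) C_le n_le d_gt1; rewrite -muln2; nia.
have [v vA vC] : exists2 v, v \in A u0 & v \notin C.
  apply/subsetPn; apply: contraL (A_large _ u0N) => /subset_leq_card.
  by rewrite C_eq -leqNgt.
move: vA; rewrite inE => /andP[vo /forall_inP vA].
have vS : v \in S by move: vo; rewrite inE => /andP[].
(* The two disjoint parts have [d - 1] and [n - d = d] elements, too many for an indegree when
   [1 < d]. *)
have : (N :\ u0) :|: (opp :\: N) \subset inN S v.
  apply/subsetP => x; rewrite in_setU => /orP[xN|xO].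
    by rewrite inE vA // NS //; move: xN; rewrite in_setD1 => /andP[].
  rewrite inE oppS //=; apply: arcN.
    by apply: own_opp => //; move: xO; rewrite in_setD => /andP[].
  (* The in-neighbourhood of [x] contains [C], which already has the maximal size [d]; so an arc
     from [v] to [x] would put [v] in [C]. *)
  apply: contra vC => Dvx; have /eqP -> : C == inN S x.
    by rewrite eqEcard C_sub // C_eq d_max // oppS.
  by rewrite inE vS.
move/subset_leq_card; rewrite cardsU.
have -> : (N :\ u0) :&: (opp :\: N) = set0.
  by apply/setP => x; rewrite in_setI in_setD1 in_setD in_set0; case: (x \in N); rewrite ?andbF.
have := cardsD1 u0 N; rewrite u0N d_w cards0 card_oppN.
by have := d_max vS; move: n_eq d_gt1; rewrite -muln2; lia.
Qed.

End LargeDegree.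

(** * Degree sums and the induction *)

Definition degree_sum S := \sum_(x in S) #|nb S x|.

(** Removing [u] loses its own degree and one unit at each of its neighbours. *)
Lemma degree_sumD1 S u : u \in S ->
  degree_sum (S :\ u) + #|nb S u|.*2 = degree_sum S.
Proof.
move=> uS; rewrite /degree_sum [RHS](big_setD1 u) //= addnC -addnn -addnA.
congr (_ + _).
have -> : #|nb S u| = \sum_(x in S :\ u) (comp12_adj D x u).
  rewrite -sum1_card big_mkcond [RHS]big_mkcond; apply: eq_bigr => x _.
  rewrite !inE comp12_sym; case: eqP => [->|_] /=; last first.
    by case: (x \in S); case: (comp12_adj D x u).
  by rewrite comp12_irr andbF.
rewrite -big_split; apply: eq_bigr => x _ /=.
rewrite (cardsD1 u (nb S x)) inE uS /=; congr (_ + _).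
by apply: eq_card => y; rewrite !inE andbA.
Qed.

Lemma degree_sum_sub S S' : S \subset S' -> degree_sum S <= degree_sum S'.
Proof.
move=> sub; rewrite /degree_sum [X in _ <= X](big_setID S) /= (setIidPr sub).
apply: leq_trans (leq_addr _ _); apply: leq_sum => x _.
apply: subset_leq_card; apply/subsetP => y; rewrite !inE.
by case/andP=> /(subsetP sub) ->.
Qed.

Lemma degree_sum_lower n S :
  (forall b, n <= #|side S b|) -> 4 < #|side S true| + #|side S false| ->
  n * n.-1 <= degree_sum S.
Proof.
elim: n S => // n IHn S le_n gt4; case: n IHn le_n => [|[|n]] IHn le_n //.
  (* Case of size 2. Were all indegrees at most 1, the side sizes [a, b >= 2] would satisfy
     [a * b <= a + b], forcing [a = b = 2]. *)
  have [y yS] : exists2 y, y \in S & 1 < #|inN S y|.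
    apply/exists_inP; apply: contraT; rewrite negb_exists_in => /forall_inP.
    move=> in1; have := @card_side_le S 1.
    have H y : y \in S -> #|inN S y| <= 1 by move/in1; rewrite -leqNgt.
    move/(_ H); move: (le_n true) (le_n false) gt4.
    by nia.
  case/card_gt1P => u [v []]; rewrite !inE => /andP[uS Duy] /andP[vS Dvy] uv.
  rewrite -(degree_sumD1 uS); suff : 0 < #|nb S u| by lia.
  apply/card_gt0P; exists v; rewrite inE vS.
  exact: (comp12_common D_asym) Duy Dvy.
(* Both sides are trimmed to exactly [n.+3] vertices. *)
have [B0 sub0 card0] := card_subset_exists (le_n false).
have [B1 sub1 card1] := card_subset_exists (le_n true).
pose S' := B0 :|: B1.
have S'S : S' \subset S.
  rewrite subUset; apply/andP; split.
    by apply: subset_trans sub0 _; apply/subsetP => x; rewrite inE => /andP[].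
  by apply: subset_trans sub1 _; apply/subsetP => x; rewrite inE => /andP[].
have card_side b : #|side S' b| = n.+3.
  case: b; [rewrite -card1|rewrite -card0]; apply: eq_card => x; rewrite !inE.
    have := subsetP sub0 x; have := subsetP sub1 x; rewrite !inE.
    by case: (x \in B1) => [/(_ isT)/andP[_ ->]|_]; rewrite ?orbT //;
      case: (x \in B0) => // /(_ isT)/andP[_ /eqP->].
  have := subsetP sub1 x; have := subsetP sub0 x; rewrite !inE.
  by case: (x \in B0) => [/(_ isT)/andP[_ ->]|_]; rewrite ?orbT //;
    case: (x \in B1) => // /(_ isT)/andP[_ /eqP->].
apply: leq_trans (degree_sum_sub S'S).
have [y0 y0S] : exists y, y \in S'.
  have : 0 < #|side S' true| by rewrite card_side.
  by case/card_gt0P => y; rewrite inE => /andP[yS' _]; exists y.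
case: (arg_maxnP (fun y => #|inN S' y|) y0S) => w wS' wmax.
(* With [d] the maximum indegree, this reads [n.+3 * n.+3 <= d * (n.+3 + n.+3)], whence
   [n.+3 <= d.*2] and [1 < d]. *)
have := card_side_le wmax; rewrite !card_side => le_d.
have [u uS' deg_u] : exists2 u, u \in S' & n.+3 <= #|nb S' u|.+1.
  apply: (@large_degree S' n.+3 #|inN S' w| w) => //; move: le_d; nia.
rewrite -(degree_sumD1 uS').
have side_D1 b : #|side (S' :\ u) b| = n.+3 - (c u == b).
  rewrite -(card_side b) (cardsD1 u (side S' b)) [u \in _]inE uS' /= addKn.
  by apply: eq_card => x; rewrite !inE andbA.
(* The sides left have sizes [n.+3] and [n.+2], and [n.+2 * n.+1 + 2 * n.+2 = n.+3 * n.+2]. *)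
have := IHn (S' :\ u).
have le2 b : n.+2 <= #|side (S' :\ u) b| by rewrite side_D1; case: eqP; lia.
have gt : 4 < #|side (S' :\ u) true| + #|side (S' :\ u) false|.
  by rewrite !side_D1; case: (c u); lia.
by move/(_ le2 gt) => /=; nia.
Qed.

End Degrees.

(** * Edge counts and the extremal orientations *)

Lemma degree_sum_edges (T : finType) (D : rel T) :
  degree_sum D [set: T] <= #|edges (comp12 D)|.*2.
Proof.
pose P := [set p : T * T | comp12 D p.1 p.2].
have -> : degree_sum D [set: T] = \sum_(p in P) 1.
  rewrite /degree_sum; under eq_bigr => x _ do rewrite -sum1_card.
  rewrite pair_big_dep; apply: eq_bigl => -[x y] /=; by rewrite !inE.
(* Ordered adjacent pairs are grouped by the edge they span, at most two per edge. *)
rewrite (partition_big_imset (fun p => [set p.1; p.2])) /=.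
have -> : [set [set p.1; p.2] | p in P] = edges (comp12 D).
  by apply/setP => e; apply/imsetP/imsetP => -[p pP ->]; exists p;
    rewrite // !inE in pP *.
rewrite -mul2n mulnC -sum_nat_const; apply: leq_sum => e.
case/imsetP => -[a b] _ /= ->.
rewrite sum1_card (leq_trans _ (_ : #|[set (a, b); (b, a)]| <= 2)) //; last first.
  by rewrite cards2; case: eqP.
apply: subset_leq_card; apply/subsetP => -[x y] /andP[].
rewrite inE /= => Gxy /eqP exy.
have xy : x != y by case/andP: Gxy.
have := set21 x y; have := set22 x y; rewrite exy !inE !xpair_eqE.
by move=> /orP[] /eqP ey /orP[] /eqP ex; move: xy; rewrite ex ey !eqxx ?orbT.
Qed.

(** Vertices without out-arcs are isolated, so every edge lies inside the side of size [n]. *)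
Lemma card_edges_one_way (m n : nat) :
  #|edges (comp12 (fun x y : 'I_m + 'I_n =>
      if (x, y) is (inr _, inl _) then true else false))| <= 'C(n, 2).
Proof.
set D := fun _ => _; pose V : {set 'I_m + 'I_n} := inr @: [set: 'I_n].
have cV : #|V| = n by rewrite card_imset ?cardsT ?card_ord //; apply: inr_inj.
rewrite -[X in 'C(X, 2)]cV -cards_draws; apply: subset_leq_card; apply/subsetP => e.
case/imsetP=> -[x y]; rewrite inE /= => xy ->; rewrite inE cards2.
have [[x' Dx] [y' Dy]] := comp12_out xy; case/andP: (xy) => -> _.
rewrite eqxx andbT; apply/subsetP => z; rewrite !inE.
case: x Dx {xy} => // i _; case: y Dy => // j _.
by case/orP=> /eqP ->; apply: imset_f; rewrite inE.
Qed.

(** This [D] is a directed 4-cycle: all indegrees are 1, which [comp12_in] excludes for a graph with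
    an edge. *)
Lemma edges_cycle4 (D : rel ('I_2 + 'I_2)) :
  (forall x y, D x y = match x, y with
    | inl i, inr j => i == j
    | inr i, inl j => i != j
    | _, _ => false end) ->
  #|edges (comp12 D)| = 0.
Proof.
move=> DE; apply/eqP; rewrite cards_eq0 -subset0; apply/subsetP => e.
case/imsetP=> -[x y]; rewrite inE /= => /comp12_in[a [b [w [ab Da Db]]]] _.
exfalso; move: ab Da Db; rewrite !DE.
case: a => a; case: b => b; case: w => w //.
  by move=> ab /eqP aw /eqP bw; rewrite aw bw eqxx in ab.
by case: a b w => -[|[|[]]] // ? [] [|[|[]]] // ? [] [|[|[]]] // ?.
Qed.

Theorem theorem4p2 (m n : nat) (D : rel ('I_m + 'I_n)%type)
    (G : sgraph ('I_m + 'I_n)%type) :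
  0 < n -> n <= m ->
  orientation (Kmn m n) D ->
  G = comp12 D ->
  (forall D' : rel ('I_m + 'I_n)%type, orientation (Kmn m n) D' ->
     #|edges G| <= #|edges (comp12 D')|) ->
  #|edges G| = if (m == 2) && (n == 2) then 0 else 'C(n, 2).
Proof.
move=> n_gt0 le_nm orD -> {G} minD.
case: ifP => [/andP[/eqP m2 /eqP n2]|mn].
  subst m n; apply/eqP; rewrite -leqn0.
  pose C4 : rel ('I_2 + 'I_2) := fun x y => match x, y with
    | inl i, inr j => i == j
    | inr i, inl j => i != j
    | _, _ => false end.
  rewrite -[X in _ <= X](@edges_cycle4 C4) //.
  apply: minD => -[i|i] [j|j] //=.
    by rewrite /C4 /= [j == i]eq_sym; case: (i == j).
  by rewrite /C4 /= [j == i]eq_sym; case: (i == j).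
apply/eqP; rewrite eqn_leq; apply/andP; split.
  by apply: leq_trans (minD _ _) (card_edges_one_way m n); case=> ? [].
have [n2|n1] := leqP 2 n; last by rewrite bin_small.
pose c (x : 'I_m + 'I_n) := if x is inl _ then true else false.
have D_asym x y : ~~ (D x y && D y x) by case: (orD x y).
have D_bip x y : D x y || D y x = (c x != c y).
  by case: (orD x y) => <- _; case: x y => ? [].
have side1 : #|side c setT true| = m.
  rewrite -[RHS]card_ord -[RHS]cardsT -[RHS](card_imset _ (@inl_inj _ 'I_n)).
  apply: eq_card => -[i|i]; rewrite !inE /=; last by apply/esym/imsetP => -[].
  by rewrite imset_f ?inE.
have side0 : #|side c setT false| = n.
  rewrite -[RHS]card_ord -[RHS]cardsT -[RHS](card_imset _ (@inr_inj 'I_m _)).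
  apply: eq_card => -[i|i]; rewrite !inE /=; first by apply/esym/imsetP => -[].
  by rewrite imset_f ?inE.
have := leq_trans (@degree_sum_lower _ D c D_asym D_bip n setT _ _)
  (degree_sum_edges D).
rewrite side1 side0 bin2 => H; rewrite -leq_double.
apply: leq_trans (H _ _).
- by rewrite -[X in _ <= X]odd_double_half leq_addl.
- by case; rewrite ?side1 ?side0.
(* Since [2 <= n <= m] and the sizes are not both 2, [m + n] exceeds 4. *)
- by move: mn; lia.
Qed.
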